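(* Let $A$ be a real $n\times n$ matrix and $B$ a real $n\times r$ matrix with $\operatorname{rank}B=r$. If the pair $(A,B)$ is controllable and $\bar s_1,\dots,\bar s_{n-r}$ are distinct real numbers none of which is an eigenvalue of $A$, then there exists an $r\times n$ matrix $C$ such that the system $\dot x=Ax+Bu$, $y=Cx$ has zero polynomial $\bar\psi(s)=\prod_{i=1}^{n-r}(s-\bar s_i)$ (up to a nonzero constant factor) and the pair $(A,C)$ is observable.
   Context: The zero polynomial of the square system $\dot x=Ax+Bu$, $y=Cx$ (with $r$ inputs and $r$ outputs) is the polynomial $\det\begin{bmatrix}sI_n-A&-B\\C&O\end{bmatrix}$, taken up to a nonzero constant factor; its zeros are the system zeros. *)

(* Defs.v *)
From mathcomp Require Import all_boot all_order all_algebra.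
From mathcomp Require Import reals.
Set Implicit Arguments.
Unset Strict Implicit.
Unset Printing Implicit Defensive.
Import GRing.Theory.
Local Open Scope ring_scope.

(* [B, AB, ..., A^(n-1) B] *)
Definition controllability_mx (F : fieldType) (n r : nat)
    (A : 'M[F]_n) (B : 'M[F]_(n, r)) :=
  \mxrow_(k < n) (A ^+ k *m B).

(* The rows of C, CA, ..., C A^(n-1), stacked. *)
Definition observability_mx (F : fieldType) (n l : nat)
    (A : 'M[F]_n) (C : 'M[F]_(l, n)) :=
  \mxcol_(k < n) (C *m A ^+ k).

(* Kalman rank conditions *)
Definition controllable (F : fieldType) (n r : nat)
    (A : 'M[F]_n) (B : 'M[F]_(n, r)) : Prop :=
  \rank (controllability_mx A B) = n.

Definition observable (F : fieldType) (n l : nat)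
    (A : 'M[F]_n) (C : 'M[F]_(l, n)) : Prop :=
  \rank (observability_mx A C) = n.

(* The upper left block char_poly_mx A is s I_n - A. *)
Definition system_mx (F : fieldType) (n r : nat)
    (A : 'M[F]_n) (B : 'M[F]_(n, r)) (C : 'M[F]_(r, n)) :
    'M[{poly F}]_(n + r) :=
  block_mx (char_poly_mx A) (- map_mx polyC B) (map_mx polyC C) 0.

(* The zero polynomial is only defined up to a nonzero constant factor. *)
Definition is_zero_polynomial (F : fieldType) (n r : nat)
    (A : 'M[F]_n) (B : 'M[F]_(n, r)) (C : 'M[F]_(r, n))
    (psi : {poly F}) : Prop :=
  exists2 c : F, c != 0 & \det (system_mx A B C) = c *: psi.

(* Main.v *)
(* Choose u_i such that the vectors v_i = (s_i - A)^-1 B u_i complete the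
   columns of B to a basis, and let C vanish on the v_i with C B = 1. The u_i
   are found greedily: if W, spanned by the columns of B and some of the v_i,
   contains (s - A)^-1 B for one further s, then the resolvent identity makes W
   stable under (s - A)^-1, hence under A, so W is everything by
   controllability. In the basis (v_i, B) the system matrix has determinant
   prod (x - s_i). An unobservable vector is a combination of the v_i on which
   A acts as diag(s_i), so it is killed by prod (A - s_i), which is
   invertible. *)
Require Import Defs.
From mathcomp Require Import all_boot all_order all_algebra.
From mathcomp Require Import reals.
Set Implicit Arguments.
Unset Strict Implicit.
Unset Printing Implicit Defensive.
Import GRing.Theory.
Local Open Scope ring_scope.

(** A one-sided inverse of a square matrix is two-sided; the last four identities are the blocks of
    the product in the opposite order. *)
Lemma row_col_inv (K : comPzRingType) (m r : nat)
    (V : 'M[K]_(m + r, m)) (B : 'M[K]_(m + r, r))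
    (D : 'M[K]_(m, m + r)) (C : 'M[K]_(r, m + r)) :
  row_mx V B *m col_mx D C = 1%:M ->
  [/\ V *m D + B *m C = 1%:M, D *m V = 1%:M, D *m B = 0, C *m V = 0
    & C *m B = 1%:M].
Proof.
move=> TT; have VDBC : V *m D + B *m C = 1%:M by rewrite -mul_row_col.
by move: (mulmx1C TT); rewrite mul_col_row [RHS]scalar_mx_block => /eq_block_mx[].
Qed.

(* [V] spans the kernel of [C], and [D] is the projection onto it along the
   image of [B]. The hypothesis [AV] says that each column [v] of [V] lies in
   a zero direction: [(sigma_i - A) v] belongs to the image of [B]. *)
Lemma det_system_block (K : comPzRingType) (m r : nat) (x : K)
    (A : 'M[K]_(m + r)) (B : 'M[K]_(m + r, r)) (C : 'M[K]_(r, m + r))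
    (V : 'M[K]_(m + r, m)) (D : 'M[K]_(m, m + r)) (U : 'M[K]_(r, m))
    (sigma : 'rV[K]_m)
    (TT : row_mx V B *m col_mx D C = 1%:M)
    (AV : A *m V = V *m diag_mx sigma - B *m U) :
  \det (block_mx (x%:M - A) (- B) C 0) = \prod_i (x - sigma 0 i).
Proof.
have [VDBC DV DB CV CB] := row_col_inv TT.
have VD : 1%:M - B *m C = V *m D by rewrite -VDBC addrK.
pose P := col_mx (D *m (x%:M - A)) (- C).
(* Row operations of determinant 1: adding [C] times the first block row to the second creates the
   pivot [- C *m B = -1], which then clears [- B]. *)
have LPsi : block_mx 1%:M (- B) 0 1%:M *m block_mx 1%:M 0 C 1%:M
      *m block_mx (x%:M - A) (- B) C 0
    = block_mx (row_mx V B *m P) 0 (C *m (x%:M - A) + C) (- 1%:M).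
  rewrite !mulmx_block !(mul1mx, mul0mx, mulmx0, mulmx1, addr0, add0r).
  rewrite !mulNmx VD mul_row_col !mulmxN -!mulmxA DB mulmx0 oppr0.
  by rewrite CB.
have PT : P *m row_mx V B
    = block_mx (x%:M - diag_mx sigma) (- (D *m A *m B)) 0 (- 1%:M).
  rewrite mul_col_row !mulNmx CV CB oppr0 -!mulmxA !mulmxBl AV.
  rewrite !mul_scalar_mx !mulmxBr -!scalemxAr DV DB scaler0 sub0r.
  by rewrite !mulmxA DV DB mul1mx mul0mx subr0 scalemx1.
have := congr1 determinant LPsi.
rewrite !det_mulmx det_ublock det_lblock !det1 !mul1r => ->.
(* Swapping the square factors under the determinant gives the block triangular [PT]; the two blocks
   [-1] of size [r] cancel in sign. *)
rewrite det_lblock det_mulmx [_ * \det P]mulrC -det_mulmx PT det_ublock.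
rewrite -mulrA -det_mulmx mulNmx mulmxN opprK mul1mx det1 mulr1.
rewrite -[x%:M]diag_const_mx.
by rewrite -raddfB det_diag; apply: eq_bigr => i _; rewrite !mxE.
Qed.

Lemma row_diag_mul (K : pzSemiRingType) (m n : nat) (d : 'rV[K]_m)
    (M : 'M[K]_(m, n)) (i : 'I_m) :
  row i (diag_mx d *m M) = d 0 i *: row i M.
Proof. by rewrite row_mul row_diag_mx -scalemxAl -rowE. Qed.

Lemma not_eigenvalue_unit (F : fieldType) (n : nat) (A : 'M[F]_n) (a : F) :
  ~~ eigenvalue A a -> a%:M - A \in unitmx.
Proof.
rewrite negbK /eigenspace kermx_eq0 row_free_unit => u.
by rewrite -opprB -scaleN1r unitmxZ ?unitrN1.
Qed.

Lemma tr_not_eigenvalue_unit (F : fieldType) (n : nat) (A : 'M[F]_n) (a : F) :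
  ~~ eigenvalue A a -> a%:M - A^T \in unitmx.
Proof.
by move=> /not_eigenvalue_unit; rewrite -unitmx_tr linearB /= tr_scalar_mx.
Qed.

(** By induction on [k], invariance puts each [(A ^+ k *m B)^T] inside [W]. Subspaces are row
    spaces, hence the transposes. *)
Lemma controllable_invariant_full (F : fieldType) (n r p : nat)
    (A : 'M[F]_n) (B : 'M[F]_(n, r)) (W : 'M[F]_(p, n)) :
  controllable A B -> (B^T <= W)%MS -> stablemx W A^T -> \rank W = n.
Proof.
move=> ctrl BW WA; apply/eqP; rewrite eqn_leq rank_leq_col /=.
rewrite -[X in (X <= _)%N]ctrl -mxrank_tr mxrankS // /controllability_mx.
have sub k : ((A ^+ k *m B)^T <= W)%MS.
  elim: k => [|k IH]; first by rewrite expr0 mul1mx.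
  rewrite exprS -mulmxE -mulmxA trmx_mul.
  exact: submx_trans (submxMr _ IH) WA.
rewrite tr_mxrow.
under eq_mxcol => k do rewrite -(mulmxKpV (sub k)).
by rewrite -mxcol_mul submxMl.
Qed.

(* [(s - A^T)^-1] maps [v_i] into the span of [v_i] and
   [B^T (s - A^T)^-1], so if the latter lay in the span [W] of [B^T] and the
   [v_i], then [W] would be invariant. *)
Lemma zero_directions_step (F : fieldType) (n r : nat) (I : finType)
    (P : pred I) (A : 'M[F]_n) (B : 'M[F]_(n, r)) (s : I -> F) (t : F)
    (v : I -> 'rV[F]_n) :
  controllable A B -> ~~ eigenvalue A t ->
  (forall i, P i -> s i != t) ->
  (forall i, P i -> (v i *m ((s i)%:M - A^T) <= B^T)%MS) ->
  let W := (B^T + \sum_(i | P i) <<v i>>)%MS in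
  exists2 w : 'rV_n, (w *m (t%:M - A^T) <= B^T)%MS
    & (n <= \rank W)%N || ~~ (w <= W)%MS.
Proof.
move=> ctrl /tr_not_eigenvalue_unit Rt st vB W.
set M := t%:M - A^T in Rt *.
have [BW|/row_subPn[j Bj]] := boolP (B^T *m invmx M <= W)%MS; last first.
  exists (row j (B^T *m invmx M)); last by rewrite Bj orbT.
  by rewrite row_mul -mulmxA mulVmx // mulmx1 row_sub.
(* In this case [W] turns out to be the whole space, so [w] is a mere placeholder. *)
exists 0; first by rewrite mul0mx sub0mx.
rewrite (@controllable_invariant_full _ _ _ _ A B W) ?leqnn ?addsmxSl //.
have vW i : P i -> (v i <= W)%MS.
  move=> Pi; apply: submx_trans (addsmxSr _ _).
  by apply: (sumsmx_sup i) => //; rewrite genmxE.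
have WM : (W *m invmx M <= W)%MS.
  rewrite addsmxMr addsmx_sub BW sumsmxMr_gen; apply/sumsmx_subP => i Pi.
  rewrite genmxE (eqmxMr _ (genmxE _)).
  have dst : s i - t != 0 by rewrite subr_eq0 st.
  have [u uB] := submxP (vB i Pi).
  have vM : v i *m M = u *m B^T - (s i - t) *: v i.
    rewrite -uB /M !mulmxBr !mul_mx_scalar scalerBl.
    by rewrite opprB [RHS]addrC addrA subrK.
  (* The resolvent identity, obtained by solving [vM] for [v i *m invmx M]. *)
  have -> : v i *m invmx M = (s i - t)^-1 *: (u *m B^T *m invmx M - v i).
    rewrite -[X in _ *m _ - X](mulmxK Rt) -mulmxBl vM subKr -scalemxAl scalerA.
    by rewrite mulVf // scale1r.
  apply/scalemx_sub/addmx_sub; last by rewrite eqmx_opp vW.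
  by rewrite -mulmxA; apply: submx_trans (submxMl _ _) BW.
have WM' : (W *m M <= W)%MS.
  (* Multiplication by [invmx M] preserves the rank, so the inclusion [WM] is an equality and can be
     multiplied back by [M]. *)
  have eqW : (W *m invmx M == W)%MS.
    rewrite -(mxrank_leqif_eq WM) mxrankMfree // row_free_unit unitmx_inv //.
  by rewrite -(eqmxMr M (eqmxP eqW)) mulmxKV.
have -> : A^T = t%:M - M by rewrite /M subKr.
rewrite mulmxBr mul_mx_scalar addmx_sub ?scalemx_sub //.
by rewrite eqmx_opp.
Qed.

(** Greedy choice, one direction per induction step; [v i] is arbitrary for [i >= k]. *)
Lemma zero_directions (F : fieldType) (n m r : nat)
    (A : 'M[F]_n) (B : 'M[F]_(n, r)) (s : 'I_m -> F) (k : nat) :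
  \rank B = r -> controllable A B -> injective s ->
  (forall i, ~~ eigenvalue A (s i)) ->
  (k <= m)%N -> (m + r <= n)%N ->
  exists2 v : 'I_m -> 'rV[F]_n,
    (forall i : 'I_m, (i < k)%N -> (v i *m ((s i)%:M - A^T) <= B^T)%MS)
    & (k + r <= \rank (B^T + \sum_(i : 'I_m | (i < k)%N) <<v i>>)%MS)%N.
Proof.
move=> rB ctrl sinj seig + mrn.
elim: k => [_|k IH lt_km].
  exists (fun=> 0) => //; rewrite add0n -[X in (X <= _)%N]rB -mxrank_tr.
  by rewrite mxrankS // addsmxSl.
have [v vB rW] := IH (ltnW lt_km).
pose j := Ordinal lt_km.
have sj (i : 'I_m) : (i < k)%N -> s i != s j.
  by move=> ik; rewrite (inj_eq sinj) -val_eqE /= ltn_eqF.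
have [w wB Ww] := zero_directions_step ctrl (seig j) sj vB.
pose v' i := if i == j then w else v i.
have v'E (i : 'I_m) : (i < k)%N -> v' i = v i.
  by move=> ik; rewrite /v' -val_eqE /= ltn_eqF.
exists v'.
  move=> i; rewrite ltnS leq_eqVlt => /predU1P[ik|ik]; last by rewrite v'E ?vB.
  by rewrite (_ : i = j) /v' ?eqxx //; apply: val_inj.
set W := (X in (_ <= \rank X)%N) in rW; set W' := (X in (_ <= \rank X)%N).
have WW' : (W <= W')%MS.
  rewrite addsmxS //; apply/sumsmx_subP => i ik.
  by apply: (sumsmx_sup i); rewrite ?v'E // ltnS ltnW.
have wW' : (w <= W')%MS.
  apply: submx_trans (addsmxSr _ _); apply: (sumsmx_sup j) => //=.
  by rewrite genmxE /v' eqxx.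
(* If [W] is already full, its rank [n >= m + r] covers the new bound; otherwise [w] raises the rank
   by at least one. *)
case/orP: Ww => [fullW|nW].
  apply: leq_trans (mxrankS WW'); apply: leq_trans fullW.
  by apply: leq_trans mrn; rewrite leq_add2r.
rewrite addSn (leq_ltn_trans rW) // rank_ltmx // ltmxE WW'.
by apply: contra nW; apply: submx_trans.
Qed.

Lemma zero_directions_basis (F : fieldType) (m r : nat)
    (A : 'M[F]_(m + r)) (B : 'M[F]_(m + r, r)) (s : 'I_m -> F) :
  \rank B = r -> controllable A B -> injective s ->
  (forall i, ~~ eigenvalue A (s i)) ->
  exists V : 'M[F]_(m + r, m), exists2 U : 'M[F]_(r, m),
    A *m V = V *m diag_mx (\row_i s i) - B *m U & row_mx V B \in unitmx.
Proof.
move=> rB ctrl sinj seig.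
have [v vB rW] := zero_directions rB ctrl sinj seig (leqnn m) (leqnn _).
have u_ i : exists u, v i *m ((s i)%:M - A^T) == u *m B^T.
  by have /submxP[u ->] := vB i (ltn_ord i); exists u.
pose U := \matrix_i xchoose (u_ i); pose V := \matrix_i v i.
exists V^T, U^T; last first.
  rewrite -unitmx_tr tr_row_mx trmxK -row_full_unit -col_leq_rank.
  apply: leq_trans rW (mxrankS _); rewrite addsmx_sub; apply/andP; split.
    by rewrite -addsmxE addsmxSr.
  apply/sumsmx_subP => i _; rewrite genmxE -addsmxE.
  by apply: submx_trans (addsmxSl _ _); rewrite -(rowK v i) row_sub.
apply: trmx_inj; rewrite linearB /= !trmx_mul !trmxK tr_diag_mx.
apply/row_matrixP => i; rewrite linearB /= row_mul rowK.
rewrite [row i (U *m _)]row_mul rowK -(eqP (xchooseP (u_ i))).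
by rewrite row_diag_mul mxE rowK mulmxBr mul_mx_scalar subKr.
Qed.

(* If [y = V a] is unobservable then so is [(A - s_j) y], which equals
   [V (S - s_j) a] since [C B = 1]. This kills the coefficients of [y] one by
   one, while each [A - s_j] is injective. *)
Lemma zero_directions_observable (F : fieldType) (m r : nat)
    (A : 'M[F]_(m + r)) (B : 'M[F]_(m + r, r)) (C : 'M[F]_(r, m + r))
    (V : 'M[F]_(m + r, m)) (D : 'M[F]_(m, m + r)) (U : 'M[F]_(r, m))
    (s : 'I_m -> F)
    (TT : row_mx V B *m col_mx D C = 1%:M)
    (AV : A *m V = V *m diag_mx (\row_i s i) - B *m U)
    (seig : forall i, ~~ eigenvalue A (s i)) :
  observable A C.
Proof.
have [VDBC _ _ CV CB] := row_col_inv TT.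
(* Here [j] bounds the number of coefficients still possibly nonzero; removing one uses up one order
   of the unobservability condition. *)
have unobs p (a : 'M[F]_(m, p)) j : (j <= m)%N ->
    (forall k, (k <= j)%N -> C *m (A ^+ k *m (V *m a)) = 0) ->
    (forall i : 'I_m, (j <= i)%N -> row i a = 0) -> V *m a = 0.
  elim: j a => [|j IH] a lt_jm Ca a0.
    rewrite (_ : a = 0) ?mulmx0 //.
    by apply/row_matrixP => i; rewrite a0 // row0.
  pose o := Ordinal lt_jm; set S := diag_mx _ in AV.
  pose a' := S *m a - s o *: a.
  (* The condition at order 1 reads [- U *m a = 0], because [C *m V = 0] and [C *m B = 1]. *)
  have Ua : U *m a = 0.
    have := Ca 1%N isT; rewrite expr1 [A *m _]mulmxA AV mulmxBl mulmxBr -!mulmxA.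
    rewrite [C *m (V *m _)]mulmxA CV mul0mx sub0r [C *m _]mulmxA CB mul1mx.
    by move/eqP; rewrite oppr_eq0 => /eqP.
  have Va' : V *m a' = (A - (s o)%:M) *m (V *m a).
    rewrite mulmxBr mulmxBl mul_scalar_mx !mulmxA AV mulmxBl -[B *m _ *m _]mulmxA.
    by rewrite Ua mulmx0 subr0 scalemxAr.
  have A_unit : A - (s o)%:M \in unitmx.
    by rewrite -row_free_unit -kermx_eq0; exact: negbNE (seig o).
  rewrite -[LHS](mulKmx A_unit) -Va' IH ?mulmx0 // 1?ltnW //.
    move=> k kj; rewrite Va' mulmxBl mul_scalar_mx !mulmxBr -!scalemxAr.
    have AkA : A ^+ k *m A = A ^+ k.+1 by rewrite exprSr.
    by rewrite [A ^+ k *m (A *m _)]mulmxA AkA !Ca ?scaler0 ?subr0 // leqW.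
  move=> i ji; rewrite /a' linearB linearZ /= row_diag_mul mxE.
  have [->|io] := eqVneq i o; first by rewrite subrr.
  by rewrite a0 ?scaler0 ?subr0 // ltn_neqAle ji andbT eq_sym.
apply/eqP; rewrite -/(row_full _) -cokermx_eq0; set Y := cokermx _.
(* At [k = m] the Kalman rows reach far enough only if [r > 0]. *)
have CY k : (k <= m)%N -> C *m (A ^+ k *m Y) = 0.
  have [r0 _|r_gt0 le_km] := posnP r.
    by apply/matrixP => -[i lt_ir]; exfalso; move: lt_ir; rewrite r0.
  have lt_k : (k < m + r)%N by rewrite -addn1 leq_add.
  have /(congr1 (fun M => submxcol M (Ordinal lt_k))) :=
    mulmx_coker (observability_mx A C).
  by rewrite mxcol_mul mxcolK -mulmxA submxcol0.
have VDY : Y = V *m (D *m Y).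
  have := CY 0%N isT; rewrite expr0 mul1mx => CY0.
  by rewrite -[LHS]mul1mx -VDBC mulmxDl -!mulmxA CY0 mulmx0 addr0.
apply/eqP; rewrite VDY; apply: (unobs _ _ m) => //.
  by move=> k le_km; rewrite -VDY CY.
by move=> i; rewrite leqNgt ltn_ord.
Qed.

Lemma zero_assignment (F : fieldType) (m r : nat)
    (A : 'M[F]_(m + r)) (B : 'M[F]_(m + r, r)) (s : 'I_m -> F) :
  \rank B = r -> controllable A B -> injective s ->
  (forall i, ~~ eigenvalue A (s i)) ->
  exists C : 'M[F]_(r, m + r),
    is_zero_polynomial A B C (\prod_i ('X - (s i)%:P)) /\ observable A C.
Proof.
move=> rB ctrl sinj seig.
have [V [U AV T_unit]] := zero_directions_basis rB ctrl sinj seig.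
(* The rows of the inverse of [(V, B)] form the dual basis; its last [r] rows vanish on [V] and are
   dual to [B]. *)
pose T' := invmx (row_mx V B); pose D := usubmx T'; pose C := dsubmx T'.
have TT : row_mx V B *m col_mx D C = 1%:M by rewrite vsubmxK mulmxV.
exists C; split; last exact: zero_directions_observable TT AV seig.
exists 1; rewrite ?oner_neq0 // scale1r /system_mx /char_poly_mx.
(* The identities are moved to polynomial matrices, where the determinant formula applies with
   [x = 'X]. *)
have pTT : row_mx (map_mx polyC V) (map_mx polyC B)
    *m col_mx (map_mx polyC D) (map_mx polyC C) = 1%:M.
  by rewrite -map_row_mx -map_col_mx -map_mxM TT map_mx1.
rewrite (@det_system_block _ _ _ _ _ _ _ (map_mx polyC V) (map_mx polyC D)
  (map_mx polyC U) (map_mx polyC (\row_i s i)) pTT).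
  by apply: eq_bigr => i _; rewrite !mxE.
by rewrite -map_mxM AV map_mxB !map_mxM map_diag_mx.
Qed.

Theorem theorem9p1 (R : realType) (n r : nat)
    (A : 'M[R]_n) (B : 'M[R]_(n, r)) (s : 'I_(n - r) -> R)
    (rankB : \rank B = r)
    (ctrlAB : controllable A B)
    (s_distinct : injective s)
    (s_not_eig : forall i : 'I_(n - r), ~~ eigenvalue A (s i)) :
  exists C : 'M[R]_(r, n),
    is_zero_polynomial A B C (\prod_(i < n - r) ('X - (s i)%:P))
    /\ observable A C.
Proof.
(* Full column rank gives [r <= n], so that [n] can be replaced by [m + r] in all the types. *)
have def_n : (n - r + r)%N = n by rewrite subnK // -rankB rank_leq_row.
move: (n - r)%N def_n s s_distinct s_not_eig => m def_n.
case: n / def_n A B rankB ctrlAB => A B rankB ctrlAB s.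
exact: zero_assignment.
Qed.
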